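(* Let $\theta\in[0,1]$ and $k>0$. Given $W^{n}\in V_{h}$, there exists a solution of the fully discrete $\theta$-scheme at the next time level, i.e. there exists $W^{n+1}\in V_{h}$ such that, with $W^{n+\theta}=\theta W^{n+1}+(1-\theta)W^{n}$, for all $\phi\in V_{h}$ $$\Big(\frac{W^{n+1}-W^{n}}{k},\phi\Big)+\nu(W_{x}^{n+\theta},\phi_{x})+w_{d}(W_{x}^{n+\theta},\phi)+(W^{n+\theta}W_{x}^{n+\theta},\phi)+\sum_{i=0}^{1}\Big((c_{i}+w_{d})W^{n+\theta}(i)+\frac{2}{9c_{i}}(W^{n+\theta})^{3}(i)\Big)\phi(i)=0.$$
   Context: Constants: $\nu>0$, $c_{0},c_{1}>0$, $w_{d}\ge 0$. $(\cdot,\cdot)$ is the $L^{2}(0,1)$ inner product, subscript $x$ is the spatial derivative. For a partition $0=x_{0}<x_{1}<\dots<x_{N}=1$ with $I_{j}=(x_{j-1},x_{j})$, $V_{h}=\{v\in C^{0}([0,1]): v|_{I_{j}}\in P_{1}(I_{j}),\ 1\le j\le N\}$ (continuous piecewise linear functions). $k$ is the time step size. *)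

(* Defs.v *)
From HB Require Import structures.
From mathcomp Require Import all_boot all_order all_algebra.
From mathcomp Require Import all_classical all_reals all_analysis.

Set Implicit Arguments.
Unset Strict Implicit.
Unset Printing Implicit Defensive.

Import Order.TTheory GRing.Theory Num.Theory.
Import numFieldNormedType.Exports.

Local Open Scope classical_set_scope.
Local Open Scope ring_scope.

(* A partition 0 = x_0 < x_1 < ... < x_N = 1 is encoded, as in [itv_partition],
   by the sequence s = [:: x_1; ...; x_N]; thus N = size s, x_j = (0 :: s)`_j,
   and I_(j+1) is the following open interval for j < size s. *)
Definition mesh_cell (R : realType) (s : seq R) (j : nat) : set R :=
  `](0 :: s)`_j, (0 :: s)`_j.+1[.

(* Functions on [0, 1] are represented by total functions R -> R; the values
   outside [0, 1] are never constrained nor used. *)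
Definition in_Vh (R : realType) (s : seq R) (v : R -> R) : Prop :=
  {within `[0, 1], continuous v} /\
  forall j, (j < size s)%N ->
    exists2 p : {poly R}, (size p <= 2)%N &
      forall x, mesh_cell s j x -> v x = p.[x].

Definition L2dot (R : realType) (f g : R -> R) : R :=
  \int[lebesgue_measure]_(x in `]0, 1[) (f x * g x).

Definition theta_avg (R : realType) (theta : R) (W0 W1 : R -> R) : R -> R :=
  fun x => theta * W1 x + (1 - theta) * W0 x.

(* For v in V_h, [derive1 v] is the spatial derivative v_x off the mesh points,
   a Lebesgue-null set on which its value is irrelevant. *)
Definition theta_residual (R : realType) (nu wd k theta : R) (c : 'I_2 -> R)
    (W0 W1 phi : R -> R) : R :=
  let W := theta_avg theta W0 W1 in
  L2dot (fun x => (W1 x - W0 x) / k) phi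
  + nu * L2dot (derive1 W) (derive1 phi)
  + wd * L2dot (derive1 W) phi
  + L2dot (fun x => W x * derive1 W x) phi
  + \sum_(i < 2) ((c i + wd) * W i%:R + 2 / (9 * c i) * W i%:R ^+ 3)
                 * phi i%:R.

(* Main.v *)
(* In nodal values the scheme is a system F_i(v) = 0 of polynomial equations,
   where sum_i F_i(v) v_i is the residual tested with the unknown itself.  This
   sum dominates a positive multiple of |v|^2 minus a linear function of v: for
   theta > 0 take W^{n+theta} as unknown, so that the convection term telescopes
   to cubic boundary values, which the quadratic and quartic boundary terms
   absorb; for theta = 0 only the mass term depends on the unknown W^{n+1}.

   A continuous field F with sum_i F_i(v) v_i > 0 for large v has a zero: solve
   the variational inequality for F on a large simplex; by coercivity its
   solution is interior, hence a zero of F.  The variational inequality follows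
   by compactness from Scarf's combinatorial lemma, applied to the points of
   finer and finer grids ordered by each barycentric coordinate and coloured by
   the index of the least component of F. *)

Require Import Defs.
From mathcomp Require Import all_boot zify.

Set Implicit Arguments.
Unset Strict Implicit.
Unset Printing Implicit Defensive.

(** * Scarf's lemma *)

Section Scarf.
Context {X I : finType} {rk : I -> X -> nat}.

(** Dominance in Scarf's sense: no element exceeds the minima of [S] in all orders at once. *)
Definition dominant (S : {set X}) : bool :=
  [forall y, exists i, forall x in S, rk i y <= rk i x].

(** When [f] gives the minima of [S], these elements can become the minimum of an enlarged set in no
    order but [i]. *)
Definition above (f : I -> X) (i : I) : {set X} :=
  [set y | [forall k, (k != i) ==> (rk k (f k) < rk k y)]].

Definition topmost (f : I -> X) (i : I) : {set X} :=
  [set x in above f i | [forall y in above f i, rk i y <= rk i x]].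

Definition lowest (S : {set X}) (f : I -> X) : Prop :=
  forall i, f i \in S /\ forall x, x \in S -> rk i (f i) <= rk i x.

Hypothesis rk_inj : forall i, injective (rk i).

Lemma dominantP (S : {set X}) :
  reflect (forall y, exists i, forall x, x \in S -> rk i y <= rk i x)
          (dominant S).
Proof.
apply: (iffP forallP) => [domS y|domS y].
  have /existsP[i /forall_inP Hi] := domS y.
  by exists i => x; apply: Hi.
by have [i Hi] := domS y; apply/existsP; exists i; apply/forall_inP.
Qed.

Lemma dominantS (S S' : {set X}) : S \subset S' -> dominant S' -> dominant S.
Proof.
move=> /subsetP sSS' /dominantP dom; apply/dominantP => y.
by have [i Hi] := dom y; exists i => x /sSS'; apply: Hi.
Qed.

Lemma exists_lowest (S : {set X}) : S != set0 -> exists f, lowest S f.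
Proof.
move=> /set0Pn[x0 Sx0].
exists (fun i => [arg min_(x < x0 in S) rk i x]) => i.
by case: arg_minnP.
Qed.

(** Dominance applied to an element of [S] itself yields an order in which that element is the
    minimum. *)
Lemma lowest_onto (S : {set X}) (f : I -> X) :
  dominant S -> lowest S f -> f @: setT = S.
Proof.
move=> /dominantP dom fP; apply/eqP; rewrite eqEsubset; apply/andP; split.
  by apply/subsetP => _ /imsetP[i _ ->]; have [] := fP i.
apply/subsetP => x Sx; have [i Hi] := dom x; have [Sfi fi] := fP i.
apply/imsetP; exists i => //; apply: (@rk_inj i).
by apply/eqP; rewrite eqn_leq Hi //= fi.
Qed.

Lemma aboveP (f : I -> X) (i : I) (y : X) :
  reflect (forall k, k != i -> rk k (f k) < rk k y) (y \in above f i).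
Proof. by rewrite inE; apply: (iffP forallP) => h k; apply/implyP/h. Qed.

Lemma topmostP (f : I -> X) (i : I) (x : X) :
  reflect (x \in above f i /\ forall y, y \in above f i -> rk i y <= rk i x)
          (x \in topmost f i).
Proof.
rewrite /topmost in_set; apply: (iffP andP) => -[Mx xtop]; split=> //.
  by move=> y; apply: (forall_inP xtop).
exact/forall_inP.
Qed.

Lemma card_topmost (f : I -> X) (i : I) : #|topmost f i| = (above f i != set0).
Proof.
have [M0|/set0Pn[y0 My0]] := eqVneq (above f i) set0.
  apply/eqP; rewrite cards_eq0; apply/eqP/setP => x.
  by rewrite in_set0; apply/negbTE/topmostP; rewrite M0 in_set0 => -[].
have [x Mx xtop] := @arg_maxnP _ y0 (mem (above f i)) (rk i) My0.
apply/eqP/cards1P; exists x; apply/setP => z; rewrite in_set1.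
apply/topmostP/eqP => [[Mz ztop]|->]; last first.
  by split=> // y; apply: xtop.
apply: (@rk_inj i); apply/eqP; rewrite eqn_leq ztop// andbT.
exact: xtop Mz.
Qed.

(** Dominance of [S] puts [x] below all of [S] in order [i]. An element of [above f i] is then
    bounded by [x] in that order; any other is bounded in some order [k] by a minimum of [S], which
    stays the minimum when [x] is added. *)
Lemma dominant_setU1 (S : {set X}) (f : I -> X) (i : I) (x : X) :
    dominant S -> lowest S f -> f @: [set~ i] = S ->
  x \in topmost f i -> x \notin S /\ dominant (x |: S).
Proof.
move=> /dominantP domS fS fi /topmostP[Mx xtop].
have NSx : x \notin S.
  rewrite -fi; apply/negP => /imsetP[k]; rewrite !inE => ki xk.
  by move/aboveP: Mx => /(_ k ki); rewrite xk ltnn.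
split=> //; apply/dominantP => y.
have xS z : z \in S -> rk i x <= rk i z.
  have [k kx] := domS x; have [->|ki] := eqVneq i k; first exact: kx.
  have [Sfk _] := fS k; move/aboveP: Mx => /(_ k).
  by rewrite eq_sym ki ltnNge kx// => /(_ isT).
have [My|] := boolP (y \in above f i).
  exists i => z; rewrite in_setU1 => /orP[/eqP->|/xS]; first exact: xtop.
  by apply: leq_trans; apply: xtop.
rewrite inE => /forallPn[k]; rewrite negb_imply -leqNgt => /andP[ki yk].
exists k => z; have [_ fkS] := fS k; rewrite in_setU1 => /orP[/eqP->|Sz].
  by apply/(leq_trans yk)/ltnW; move/aboveP: Mx; apply.
exact/(leq_trans yk)/fkS.
Qed.

(** [x |: S] has as many elements as there are orders, so its minima [g] are pairwise distinct, and
    they differ from [f] only at the order whose minimum is [x]. Since [f i = f j], that order is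
    [i] or [j]. *)
Lemma dominant_setU1_topmost (S : {set X}) (f : I -> X) (i j : I) (x : X) :
    lowest S f -> #|S|.+1 = #|I| -> i != j -> f i = f j ->
    x \notin S -> dominant (x |: S) ->
  (x \in topmost f i) || (x \in topmost f j).
Proof.
move=> fS cS ij fij NSx dom.
have xS0 : x |: S != set0 by apply/set0Pn; exists x; rewrite setU11.
have [g gS] := exists_lowest xS0.
have gonto := lowest_onto dom gS.
have ginj : injective g.
  have /imset_injP ginj : #|g @: setT| == #|[set: I]|.
    by rewrite gonto cardsU1 NSx cardsT add1n cS.
  by move=> a b; apply: ginj; rewrite inE.
have [k0 gk0] : exists k0, g k0 = x.
  have /imsetP[k0 _ ->] : x \in g @: setT by rewrite gonto setU11.
  by exists k0.
have gf k : k != k0 -> g k = f k.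
  move=> kk0; have [gkS gk] := gS k; have [fkS fk] := fS k.
  apply: (@rk_inj k); apply/eqP; rewrite eqn_leq gk ?setU1r//= fk//.
  move: gkS; rewrite in_setU1 -gk0 => /orP[/eqP/ginj/eqP|//].
  by rewrite (negbTE kk0).
have xtop : x \in topmost f k0.
  apply/topmostP; split=> [|y /aboveP My].
    apply/aboveP => k kk0; have [gkS gk] := gS k.
    rewrite -gf// ltn_neqAle gk ?setU11// andbT; apply/eqP => /rk_inj.
    by rewrite -gk0 => /ginj/eqP; rewrite (negbTE kk0).
  move/dominantP: dom => /(_ y)[k ky].
  have [kk0|kk0] := eqVneq k k0; first by rewrite -kk0; apply: ky; rewrite setU11.
  have [gkS _] := gS k.
  by have := My k kk0; rewrite -gf// ltnNge ky.
have [->|ik0] := eqVneq i k0; first by rewrite xtop.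
have [->|jk0] := eqVneq j k0; first by rewrite xtop orbT.
by move/eqP: fij; rewrite -!gf// (inj_eq ginj) (negbTE ij).
Qed.

(* A dominant set with one element fewer than there are orders has exactly one
   coincidence [f i = f j] among its minima, and can only be completed by the
   topmost element above it for [i] or for [j]. *)
Lemma odd_card_completions (S : {set X}) :
    dominant S -> S != set0 -> #|S|.+1 = #|I| ->
  exists f i j, [/\ lowest S f, i != j, f i = f j &
    odd #|[set x | (x \notin S) && dominant (x |: S)]| =
      (above f i != set0) (+) (above f j != set0)].
Proof.
move=> dom S0 cS; have [f fS] := exists_lowest S0.
have fonto := lowest_onto dom fS.
have [i [j [ij fij]]] : exists i j, i != j /\ f i = f j.
  have /injectivePn[i [j ij fij]] : ~~ injectiveb f.
    apply/injectiveP => finj; have := card_imset [set: I] finj.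
    by rewrite fonto cardsT -cS => /eqP; rewrite ltn_eqF.
  by exists i, j.
have fC a b : a != b -> f a = f b -> f @: [set~ a] = S.
  move=> ab fab; rewrite -fonto; apply/setP => x.
  apply/imsetP/imsetP => -[k _ ->]; first by exists k.
  have [->|ka] := eqVneq k a; last by exists k; rewrite ?inE.
  by exists b => //; rewrite !inE eq_sym.
exists f, i, j; split=> //.
rewrite -(oddb (above f i != _)) -(oddb (above f j != _)) -oddD -!card_topmost.
(* A common element would exceed the minimum of [S] in every order. *)
rewrite -cardsUI; have -> : topmost f i :&: topmost f j = set0.
  apply/setP => x; rewrite !inE -/(_ \in _); apply/negP.
  move=> /andP[/andP[/forallP Mi _] /andP[/forallP Mj _]].
  move/dominantP: dom => /(_ x)[k kx]; have [fkS _] := fS k.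
  have [ki|ki] := eqVneq k i.
    have /implyP := Mj k; rewrite ltnNge kx// => /(_ _)/negP; apply=> //.
    by rewrite ki.
  by have /implyP := Mi k; rewrite ltnNge kx// ki => /(_ isT).
rewrite cards0 addn0; congr (odd #|pred_of_set _|); apply/setP => x.
rewrite in_setU inE; apply/idP/idP => [/andP[]|].
  exact: dominant_setU1_topmost.
case/orP.
  by case/(dominant_setU1 dom fS (fC _ _ ij fij)) => -> ->.
rewrite eq_sym in ij.
by case/(dominant_setU1 dom fS (fC _ _ ij (esym fij))) => -> ->.
Qed.

(* The slack element [m i] stands for the omission of the order [i]: a dominant
   set containing it can never use [i] as a witness. *)
Context {m : I -> X} {c : X -> I}.
Hypothesis m_lowest : forall i x, rk i (m i) <= rk i x.
Hypothesis m_highest : forall i k x,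
  x \notin codom m -> k != i -> rk k x < rk k (m i).
Hypothesis cm : cancel m c.

Lemma lowest_slack (S : {set X}) (f : I -> X) (i : I) :
  lowest S f -> m i \in S -> f i = m i.
Proof.
move=> fS Smi; have [_ fi] := fS i.
by apply: (@rk_inj i); apply/eqP; rewrite eqn_leq fi// m_lowest.
Qed.

(** [m i] beats the non-slack [t], hence the minima of [S], in every order but [i]. *)
Lemma slack_above (S : {set X}) (f : I -> X) (i : I) (t : X) :
  lowest S f -> t \in S -> t \notin codom m -> above f i != set0.
Proof.
move=> fS St Nmt; apply/set0Pn; exists (m i); apply/aboveP => k ki.
by apply: leq_ltn_trans (m_highest Nmt ki); have [_] := fS k; apply.
Qed.

Lemma m_injective : injective m.
Proof. exact: can_inj cm. Qed.

Lemma slack_lt (i k : I) : k != i -> rk k (m k) < rk k (m i).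
Proof.
move=> ki; rewrite ltn_neqAle m_lowest andbT; apply/eqP => /rk_inj/m_injective.
by apply/eqP.
Qed.

(** The slacks other than [m i0] form the boundary door of the parity argument. They bound every
    non-slack element in order [i0]. *)
Lemma dominant_outer (i0 : I) : 1 < #|I| -> dominant (m @: [set~ i0]).
Proof.
move=> I1; apply/dominantP => y; have [/codomP[k ->]|Ny] := boolP (y \in codom m).
  exists k => x _; exact: m_lowest.
exists i0 => _ /imsetP[k + ->]; rewrite !inE => ki.
by apply/ltnW/m_highest => //; rewrite eq_sym.
Qed.

Lemma card_outer (i0 : I) : #|m @: [set~ i0]|.+1 = #|I|.
Proof.
rewrite (card_imset _ m_injective) cardsC1 prednK//.
by apply/card_gt0P; exists i0.
Qed.

(** Here [f k = m k] for [k != i0]. A member of [above f j] would exceed [m j] in order [i0], hence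
    be a slack [m k] with [k] neither [i0] nor [j], and so exceed itself in order [k]. *)
Lemma above_outer (f : I -> X) (i0 j : I) : lowest (m @: [set~ i0]) f ->
  i0 != j -> f i0 = f j -> above f i0 != set0 /\ above f j = set0.
Proof.
move=> fS ij fij.
have fm k : k != i0 -> f k = m k.
  by move=> ki; apply: (lowest_slack fS); rewrite imset_f ?inE.
split.
  by apply/set0Pn; exists (m i0); apply/aboveP => k ki; rewrite fm// slack_lt.
apply/setP => y; rewrite in_set0; apply/negP => /aboveP Mj.
have := Mj i0 ij; rewrite fij fm 1?eq_sym// => jy.
have [/codomP[k yk]|Ny] := boolP (y \in codom m); last first.
  by have := m_highest Ny ij; rewrite ltnNge ltnW.
have [kj|kj] := eqVneq k j; first by rewrite yk kj ltnn in jy.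
have [ki|ki] := eqVneq k i0; first by rewrite yk ki ltnNge m_lowest in jy.
by have := Mj k kj; rewrite fm// yk ltnn.
Qed.

Lemma odd_completions_outer (i0 : I) : 1 < #|I| ->
  odd #|[set x | (x \notin m @: [set~ i0]) && dominant (x |: m @: [set~ i0])]|.
Proof.
move=> I1; have S0 : m @: [set~ i0] != set0.
  by rewrite -card_gt0 -ltnS card_outer.
have [f [i [j [fS ij fij ->]]]] :=
  odd_card_completions (dominant_outer i0 I1) S0 (card_outer i0).
have [ii0|ii0] := eqVneq i i0.
  rewrite ii0 in ij fij *; have [-> ->] := above_outer fS ij fij.
  by rewrite eqxx.
have [ji0|ji0] := eqVneq j i0.
  rewrite ji0 eq_sym in ij fij *; have [-> ->] := above_outer fS ij (esym fij).
  by rewrite eqxx.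
move/eqP: fij; rewrite !(lowest_slack fS) ?imset_f ?inE//.
by rewrite (inj_eq m_injective) (negbTE ij).
Qed.

(** Slacks alone, with colours [[set~ i0]], would form the outer set because [c (m k) = k]. Hence
    [S] has a non-slack element, and both terms of the parity formula are true. *)
Lemma even_completions (S : {set X}) (i0 : I) : 1 < #|I| -> dominant S ->
    #|S|.+1 = #|I| -> c @: S = [set~ i0] -> S != m @: [set~ i0] ->
  ~~ odd #|[set x | (x \notin S) && dominant (x |: S)]|.
Proof.
move=> I1 dom cS colS Sneq; have S0 : S != set0 by rewrite -card_gt0 -ltnS cS.
have [t St Nt] : exists2 t, t \in S & t \notin codom m.
  apply/exists_inP; apply: contraT => /exists_inPn Sm; case/negP: Sneq.
  rewrite eqEcard -ltnS cS card_outer leqnn andbT.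
  apply/subsetP => x Sx; have /negPn/codomP[k xk] := Sm x Sx.
  by rewrite xk imset_f// -colS -(cm k) imset_f// -xk.
have [f [i [j [fS ij fij ->]]]] := odd_card_completions dom S0 cS.
by rewrite !(slack_above _ fS St Nt).
Qed.

(* If [S] is not fully coloured but [S :\ x] carries exactly the colours other
   than [i0], the only other such deletion is that of the [z] with [c z = c x]. *)
Lemma odd_doors (S : {set X}) (i0 : I) : #|S| = #|I| ->
  odd #|[set x | (x \in S) && (c @: (S :\ x) == [set~ i0])]| = (c @: S == setT).
Proof.
move=> cS; have [colS|colS] := eqVneq.
  have cinj : {in S &, injective c}.
    by apply/imset_injP; rewrite colS cardsT cS.
  have /imsetP[x0 Sx0 cx0] : i0 \in c @: S by rewrite colS.
  suff -> : [set x | (x \in S) && (c @: (S :\ x) == [set~ i0])] = [set x0].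
    by rewrite cards1.
  apply/setP => x; rewrite !inE; apply/andP/eqP => [[Sx /eqP colx]|->].
    have [//|xx0] := eqVneq x x0.
    have : i0 \in c @: (S :\ x) by rewrite cx0 imset_f// !inE eq_sym xx0.
    by rewrite colx !inE eqxx.
  split=> //; rewrite eqEcard; apply/andP; split; last first.
    rewrite card_in_imset; last by move=> a b /setD1P[_ ?] /setD1P[_ ?]; apply: cinj.
    by rewrite cardsC1 -cS (cardsD1 x0 S) Sx0.
  apply/subsetP => _ /imsetP[z /setD1P[zx0 Sz] ->].
  by rewrite !inE cx0 (inj_in_eq cinj).
set D := finset _; have [->|/set0Pn[x]] := eqVneq D set0.
  by rewrite cards0.
rewrite inE => /andP[Sx /eqP colx].
have cSx : #|S :\ x| = #|I|.-1 by rewrite -cS (cardsD1 x S) Sx.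
have cinj : {in S :\ x &, injective c}.
  by apply/imset_injP; rewrite colx cardsC1 cSx.
have : c x \in [set~ i0].
  rewrite !inE; apply: contra colS => /eqP cxi0; rewrite -(setD1K Sx) imsetU1 colx.
  by apply/eqP/setP => k; rewrite !inE cxi0 orbN.
rewrite -colx => /imsetP[z Dz cxz]; have /setD1P[zx Sz] := Dz.
suff -> : D = [set x; z].
  by rewrite cards2 eq_sym zx.
apply/setP => y; rewrite !inE; apply/andP/orP => [[Sy /eqP coly]|[/eqP->|/eqP->]].
- have [->|yx] := eqVneq y x; [by left|right].
  have Dy : y \in S :\ x by rewrite !inE yx.
  have : c y \in c @: (S :\ y) by rewrite coly -colx imset_f.
  move=> /imsetP[w /setD1P[wy Sw] cyw].
  have [wx|wx] := eqVneq w x; first by apply/eqP/cinj => //; rewrite cyw wx.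
  by move: wy; rewrite -(inj_in_eq cinj) ?cyw ?eqxx// !inE wx.
- by rewrite colx.
- split=> //; rewrite -colx eqEsubset; apply/andP; split;
    apply/subsetP => _ /imsetP[w /setD1P[ww Sw] ->].
    have [->|wx] := eqVneq w x; first by rewrite cxz imset_f.
    by rewrite imset_f// !inE wx.
  have [->|wz] := eqVneq w z; first by rewrite -cxz imset_f// !inE eq_sym zx.
  by rewrite imset_f// !inE wz.
Qed.

Lemma odd_sum (J : finType) (P : pred J) (F : J -> nat) :
  odd (\sum_(i | P i) F i) -> exists2 i, P i & odd (F i).
Proof.
move=> oddF; apply/exists_inP; apply: contraT => /exists_inPn evenF.
suff : ~~ odd (\sum_(i | P i) F i) by rewrite oddF.
by elim/big_ind: _ => // a b ea eb; rewrite oddD (negbTE ea).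
Qed.

(** Double counting of the pairs of a door and a dominant set, or room, completing it. Counted by
    doors the total is odd, since only the outer door has an odd number of completions. Counted by
    rooms, exactly the fully coloured ones contribute an odd number, so one exists. *)
Theorem scarf : 1 < #|I| ->
  exists S : {set X}, [/\ #|S| = #|I|, dominant S & c @: S = setT].
Proof.
move=> I1; have /card_gt0P[i0 _] : 0 < #|I| by exact: ltnW.
pose door S := [&& dominant S, #|S|.+1 == #|I| & c @: S == [set~ i0]].
have odd_rooms : odd (\sum_(S | door S)
    #|[set x | (x \notin S) && dominant (x |: S)]|).
  rewrite (bigD1 (m @: [set~ i0])) /=; last first.
    rewrite /door dominant_outer// card_outer eqxx -imset_comp (eq_imset _ cm).
    by rewrite imset_id eqxx.
  rewrite oddD odd_completions_outer//=; apply/negP => /odd_sum[S /andP[]].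
  move=> /and3P[dom /eqP cS /eqP colS] Sneq.
  exact/negP/(even_completions I1 dom cS colS Sneq).
suff e : \sum_(S | door S) #|[set x | (x \notin S) && dominant (x |: S)]| =
  \sum_(S | dominant S && (#|S| == #|I|))
    #|[set x | (x \in S) && (c @: (S :\ x) == [set~ i0])]|.
  move: odd_rooms; rewrite e => /odd_sum[S /andP[dom /eqP cS]].
  by rewrite odd_doors// => /eqP colS; exists S.
under eq_bigr do rewrite -sum1dep_card.
under [RHS]eq_bigr do rewrite -sum1dep_card.
rewrite !pair_big_dep/=.
(* A room [S] with an element [x] corresponds to the door [S :\ x] with the completion [x]. *)
rewrite (reindex_onto (fun p : {set X} * X => (p.1 :\ p.2, p.2))
                      (fun p : {set X} * X => (p.2 |: p.1, p.2))) /=; last first.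
  by move=> [S x] /= /andP[_ /andP[NSx _]]; rewrite setU1K.
apply: eq_bigl => -[S x] /=; rewrite /door.
rewrite setD11 /= xpair_eqE eqxx andbT.
have [Sx|NSx] := boolP (x \in S); last first.
  rewrite andbF; apply/negbTE/negP => /andP[_ /eqP e].
  by rewrite -e setU11 in NSx.
rewrite setD1K// eqxx andbT (cardsD1 x S) Sx add1n.
have [domS|] := boolP (dominant S); last by rewrite !andbF.
by rewrite (dominantS (subD1set _ _) domS) /= andbT.
Qed.

End Scarf.

(** * Colourings of the grid points of a simplex *)

(** Barycentric coordinates scaled by [M], so that they are integers. *)
Definition simplex_grid (n M : nat) : finType :=
  {x : {ffun 'I_n -> 'I_M.+1} | \sum_i x i == M}.

Definition grid_coord (n M : nat) (t : simplex_grid n M) (i : 'I_n) : nat :=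
  val t i.

Lemma sum_grid_coord (n M : nat) (t : simplex_grid n M) :
  \sum_i grid_coord t i = M.
Proof. exact/eqP/(valP t). Qed.

(** Order [i] compares the [i]-th coordinates and breaks ties by enumeration, as a two-digit number
    in base [#|simplex_grid n M|]. The slack [inr i] comes below all grid points, the other slacks
    above them. *)
Definition grid_rank (n M : nat) (i : 'I_n)
    (x : simplex_grid n M + 'I_n) : nat :=
  match x with
  | inl t => (grid_coord t i * #|simplex_grid n M| + enum_rank t).+1
  | inr k => if k == i then 0 else (M.+1 * #|simplex_grid n M| + k).+1
  end.

Arguments grid_rank {n} M i x.

Lemma ltn_block (a b d r r' : nat) :
  r' < d -> a * d + r <= b * d + r' -> a <= b.
Proof.
move=> rd' h; rewrite leqNgt; apply/negP => ba.
have : b.+1 * d <= a * d by rewrite leq_mul2r ba orbT.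
rewrite mulSn => hh; have := leq_trans (leq_add hh (leqnn r)) h.
rewrite (addnC d) -addnA leq_add2l => /(leq_trans (leq_addr _ _)).
by rewrite leqNgt rd'.
Qed.

Lemma grid_rank_lt (n M : nat) (i k : 'I_n) (t : simplex_grid n M) :
  k != i -> grid_rank M i (inl t) < grid_rank M i (inr k).
Proof.
move=> /negbTE /= ->; rewrite ltnS mulSn [X in _ < X + _]addnC.
rewrite -addnA -addnS; apply: leq_add; first by rewrite leq_mul2r -ltnS ltn_ord orbT.
by apply: leq_trans (ltn_ord _) (leq_addr _ _).
Qed.

Lemma grid_rank_inj (n M : nat) (i : 'I_n) : injective (grid_rank M i).
Proof.
have inlr t k : grid_rank M i (inl t) = grid_rank M i (inr k) -> False.
  have [->|ki] := eqVneq k i; first by rewrite /= eqxx.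
  by have := grid_rank_lt t ki; move=> /[swap] ->; rewrite ltnn.
move=> [t|k] [t'|k']; [| by move/inlr | by move/esym/inlr | ] => /=.
  case=> e; congr inl; apply/enum_rank_inj/val_inj.
  have tt' : grid_coord t i = grid_coord t' i.
    apply/eqP; rewrite eqn_leq; apply/andP; split.
      exact: (ltn_block (ltn_ord _) (eq_leq e)).
    exact: (ltn_block (ltn_ord _) (eq_leq (esym e))).
  by move: e; rewrite tt' => /addnI.
have [ki|ki] := eqVneq k i; have [k'i|k'i] := eqVneq k' i => //.
  by rewrite ki k'i.
by case=> /addnI/val_inj ->.
Qed.

(** The excess of [M] over the sum is added to the first coordinate. *)
Lemma exists_grid_point (n M : nat) (a : 'I_n -> nat) : 0 < n ->
  \sum_i a i <= M -> exists t : simplex_grid n M, forall i, a i <= grid_coord t i.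
Proof.
move=> n0 aM; pose i0 := Ordinal n0.
pose b i := if i == i0 then a i + (M - \sum_i a i) else a i.
have bM : \sum_i b i = M.
  have aE : \sum_i a i = a i0 + \sum_(i < n | i != i0) a i by rewrite (bigD1 i0).
  rewrite (bigD1 i0)//= {1}/b eqxx (eq_bigr a); last first.
    by move=> i /negbTE ii0; rewrite /b ii0.
  by rewrite addnAC -aE subnKC.
have bi i : b i < M.+1 by rewrite ltnS -bM (bigD1 i)//= leq_addr.
have tM : \sum_i [ffun i => Ordinal (bi i)] i == M.
  by rewrite -[X in _ == X]bM; apply/eqP/eq_bigr => i _; rewrite ffunE.
exists (exist _ [ffun i => Ordinal (bi i)] tM) => i /=.
by rewrite /grid_coord ffunE /= /b; case: ifP => // _; exact: leq_addr.
Qed.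

(** Scarf's lemma for the grid points and one slack per colour. Let [C] be the set of orders whose
    slack is not in [S]. Dominance makes the minima over [C] add up to more than [M - n], so the
    grid points of [S] have coordinates within [n] of these minima in [C] and below [n] outside. A
    colour in [C] is carried by a grid point. *)
Theorem grid_coloring (n M : nat) (c : simplex_grid n M -> 'I_n) : 1 < n ->
  exists x : simplex_grid n M, forall i, grid_coord x i < n \/
    exists y, c y = i /\
      forall j, grid_coord x j < grid_coord y j + n /\
                grid_coord y j < grid_coord x j + n.
Proof.
move=> n1; pose T := simplex_grid n M.
pose col (x : T + 'I_n) := match x with inl t => c t | inr k => k end.
have highest (i k : 'I_n) (x : T + 'I_n) : x \notin codom inr -> k != i ->
    grid_rank M k x < grid_rank M k (inr i).
  case: x => [t _|j Nj _]; first by rewrite eq_sym => /grid_rank_lt.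
  by rewrite codom_f in Nj.
have lowest_inr i (x : T + 'I_n) : grid_rank M i (inr i) <= grid_rank M i x.
  by rewrite /= eqxx.
have [||S [cS /dominantP dom colS]] := scarf (@grid_rank_inj n M) lowest_inr
    highest (c := col) => //.
  by rewrite card_ord.
pose C := [set i | inr i \notin S].
pose s := [set t | inl t \in S].
(* An order whose slack is in [S] cannot be the witness: that slack has rank 0 and a grid point does
   not. *)
have domC (y : T) : exists2 i, i \in C &
    forall t, t \in s -> grid_rank M i (inl y) <= grid_rank M i (inl t).
  have [i iy] := dom (inl y); exists i; last by move=> t; rewrite inE => /iy.
  by rewrite inE; apply/negP => /iy; rewrite /= eqxx.
have [t0 _] : exists t : T, forall i, 0 <= grid_coord t i.
  by apply: exists_grid_point; [exact: ltnW | rewrite big1].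
have [t1 st1] : exists t, t \in s.
  (* Without grid points [S] would consist of all the slacks, and [C] would be empty. *)
  apply/set0Pn/negP => /eqP s0.
  have : S = inr @: [set: 'I_n].
    apply/eqP; rewrite eqEcard card_imset; last exact: inr_inj.
    rewrite cardsT cS leqnn andbT; apply/subsetP => -[t St|k _]; last exact: imset_f.
    have : t \in s by rewrite inE.
    by rewrite s0 inE.
  move=> Se; have [i + _] := domC t0.
  by rewrite inE Se imset_f.
pose mu i := grid_coord [arg min_(t < t1 in s) grid_coord t i] i.
have muP i : mu i = grid_coord [arg min_(t < t1 in s) grid_coord t i] i by [].
have mu_le i t : t \in s -> mu i <= grid_coord t i.
  by move=> st; rewrite muP; case: arg_minnP => // t' _; apply.
have mu_eq i : exists2 t, t \in s & grid_coord t i = mu i :> nat.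
  by rewrite muP; case: arg_minnP => // t' st' _; exists t'.
(* Otherwise some grid point exceeds all the minima of the orders in [C]. *)
have sumC : M < \sum_(i in C) (mu i).+1.
  rewrite ltnNge; apply/negP => leM.
  have [||y yP] := @exists_grid_point n M (fun i => if i \in C then (mu i).+1 else 0).
  - exact: ltnW.
  - by rewrite -big_mkcond.
  have [i iC yi] := domC y; have [t st ti] := mu_eq i.
  have /= := yi t st; rewrite ltnS => /(ltn_block (ltn_ord _)).
  by rewrite ti leqNgt; have := yP i; rewrite iC => ->.
have sumt (t : T) :
    \sum_(i in C) grid_coord t i + \sum_(i | i \notin C) grid_coord t i = M.
  by rewrite -[RHS](sum_grid_coord t) [RHS](bigID (mem C)).
have sumC' : M < \sum_(i in C) mu i + n.
  apply: leq_trans sumC _; under eq_bigr do rewrite -addn1.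
  rewrite big_split/= sum1_card leq_add2l -[leqRHS]card_ord; exact: max_card.
have slackC (t : T) j : t \in s -> j \notin C -> grid_coord t j < n.
  move=> st jC; have := sumt t; rewrite [X in _ + X](bigD1 j)//=.
  have : \sum_(i in C) mu i <= \sum_(i in C) grid_coord t i.
    by apply: leq_sum => i _; exact: mu_le.
  move: sumC'; set a := \sum_(_ in C) mu _.
  by set b := (\sum_(_ in C) grid_coord _ _); set d := (X in b + (_ + X)); lia.
have closeC (t : T) j : t \in s -> j \in C -> grid_coord t j < mu j + n.
  move=> st jC; have := sumt t; rewrite (bigD1 j)//=.
  have : \sum_(i in C | i != j) mu i <= \sum_(i in C | i != j) grid_coord t i.
    by apply: leq_sum => i _; exact: mu_le.
  by move: sumC'; rewrite (bigD1 j)//=; lia.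
exists t1 => i; have [iC|iC] := boolP (i \in C); last by left; exact: slackC.
right; have /imsetP[[t|k] Sx ix] : i \in col @: S by rewrite colS.
  exists t; split=> // j; have st : t \in s by rewrite inE.
  have [jC|jC] := boolP (j \in C); last first.
    by split; apply: leq_trans (leq_addl _ _); exact: slackC.
  by split; [apply: leq_trans (closeC t1 j _ _) _
            |apply: leq_trans (closeC t j _ _) _];
    rewrite // leq_add2r mu_le.
by move: iC; rewrite ix inE Sx.
Qed.

From mathcomp Require Import all_order all_algebra.
From mathcomp Require Import all_classical all_reals all_analysis measurable_realfun.
From mathcomp Require Import lra ring.
Import Order.TTheory GRing.Theory Num.Theory.
Import numFieldNormedType.Exports.
Local Open Scope classical_set_scope.
Local Open Scope ring_scope.

(** * Zeros of coercive vector fields *)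

Lemma cluster_sequence (R : realType) (n : nat) (u : nat -> 'rV[R]_n) :
    (forall m i, 0 <= u m ord0 i <= 1) ->
  exists2 p : 'rV[R]_n, forall i, 0 <= p ord0 i &
    forall (e : R) N, 0 < e -> exists2 m, (N <= m)%N &
      forall i, `|p ord0 i - u m ord0 i| < e.
Proof.
move=> u01.
have cbox := @rV_compact R n (fun=> `[0, 1]%classic) (fun=> @segment_compact _ 0 1).
have [|p [boxp clp]] := cbox (u @ \oo) _.
  by exists 0%N => // m _ i; rewrite /= in_itv/= u01.
exists p; first by move=> i; have := boxp i; rewrite /= in_itv/= => /andP[].
move=> e N e0.
have [||_ [[m Nm <-] ube]] := clp [set u m | m in [set m | (N <= m)%N]] (ball p e).
- by exists N => // m /= Nm; exists m.
- exact: nbhsx_ballx.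
- by exists m => // i; exact: (ube.2 ord0 i).
Qed.

(** Grid points are coloured by the index of the least component of [G]. At a cluster point [p] with
    [0 < p ord0 i] the [i]-th coordinates nearby are not small, so [G i] is least at points
    arbitrarily close to [p], hence at [p] by continuity. *)
Theorem simplex_complementarity (R : realType) (n : nat)
    (G : 'I_n -> 'rV[R]_n -> R) : (1 < n)%N -> (forall i, continuous (G i)) ->
  exists x : 'rV[R]_n, [/\ forall i, 0 <= x ord0 i, \sum_i x ord0 i = 1 &
    forall i j, 0 < x ord0 i -> G i x <= G j x].
Proof.
move=> n1 cG; pose i0 := Ordinal (ltnW n1).
have step m : exists x : 'rV[R]_n, [/\ forall i, 0 <= x ord0 i,
    \sum_i x ord0 i = 1 & forall i, x ord0 i < n%:R / m.+1%:R \/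
    exists2 y : 'rV[R]_n, forall j, G i y <= G j y &
      forall j, `|x ord0 j - y ord0 j| < n%:R / m.+1%:R].
  pose pt (t : simplex_grid n m.+1) : 'rV[R]_n :=
    \row_i ((grid_coord t i)%:R / m.+1%:R).
  have [t tP] := grid_coloring
    (fun t : simplex_grid n m.+1 => [arg min_(i < i0) G i (pt t)]%O) n1.
  exists (pt t); split=> [i||i].
  - by rewrite mxE divr_ge0.
  - under eq_bigr do rewrite mxE.
    by rewrite -mulr_suml -natr_sum sum_grid_coord divff.
  have [ti|[y [yi ty]]] := tP i; [left|right].
    by rewrite mxE ltr_pM2r ?ltr_nat ?invr_gt0.
  exists (pt y).
    by move=> j; rewrite -yi; case: arg_minP => // k _; apply.
  move=> j; rewrite !mxE -mulrBl normrM [X in _ * X]ger0_norm ?invr_ge0//.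
  rewrite ltr_pM2r ?invr_gt0// ltr_norml.
  have [] := ty j; rewrite -!(ltr_nat R) !natrD => xy yx; apply/andP; lra.
have [u uP] := choice step.
have [m i|p p0 clp] := @cluster_sequence R n u.
  have [u0 u1 _] := uP m; rewrite u0/= -u1 (bigD1 i)//= lerDl.
  by rewrite sumr_ge0.
have p1 : \sum_i p ord0 i = 1.
  apply/eqP; rewrite -subr_eq0 -normr_le0 leNgt; apply/negP => d0.
  set d := `|_| in d0.
  have n0 : (0 : R) < n%:R by rewrite ltr0n ltnW.
  have [m _ um] := clp (d / n%:R) 0%N (divr_gt0 d0 n0).
  suff : d < d by rewrite ltxx.
  have [_ um1 _] := uP m; rewrite {1}/d -um1 -sumrB.
  apply: le_lt_trans (ler_norm_sum _ _ _) _.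
  have -> : d = \sum_(i < n) (d / n%:R).
    by rewrite sumr_const card_ord -[RHS]mulr_natr divfK// gt_eqF.
  by apply: ltr_sum => //; apply/hasP; exists i0; rewrite ?mem_index_enum.
exists p; split=> // i j pi0; rewrite leNgt; apply/negP => Gji.
have [e e0 eP] : exists2 e : R, 0 < e &
    forall y : 'rV[R]_n, (forall k, `|p ord0 k - y ord0 k| < e) -> G j y < G i y.
  have D0 : 0 < G i p - G j p by rewrite subr_gt0.
  have /nbhs_ballP[e e0 eP] : nbhs p [set y | 0 < G i y - G j y].
    exact: cvgr_gt (cvgB (cG i p) (cG j p)) _ D0.
  exists e => // y py.
  rewrite -subr_gt0; apply: eP; split=> // a k; rewrite !ord1; exact: py.
(* The half leaves room for two errors below [e']: they add up to less than [e], and to less than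
   [p ord0 i]. *)
pose e' := Num.min e (p ord0 i) / 2.
have e'0 : 0 < e' by rewrite divr_gt0// lt_min e0.
have [N Ne] : exists N, forall m, (N <= m)%N -> n%:R / m.+1%:R < e'.
  exists (Num.truncn (n%:R / e')) => m Nm.
  rewrite ltr_pdivrMr// mulrC -ltr_pdivrMr//.
  by apply: lt_le_trans (truncnS_gt _) _; rewrite ler_nat ltnS.
have [m Nm um] := clp e' N e'0.
have ee' : e' * 2 <= e /\ e' * 2 <= p ord0 i.
  by rewrite /e' divfK//; split; rewrite ge_min lexx ?orbT.
have := Ne m Nm; have [_ _ /(_ i)] := uP m; set r := n%:R / m.+1%:R.
clearbody r e'; case=> [uim|[y yi uy]] re.
  have := um i; rewrite ltr_norml => /andP[_].
  by move: uim; case: ee' => _; lra.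
suff /eP : forall k, `|p ord0 k - y ord0 k| < e by rewrite ltNge yi.
move=> k.
have -> : p ord0 k - y ord0 k = (p ord0 k - u m ord0 k) + (u m ord0 k - y ord0 k).
  by rewrite addrA subrK.
apply: le_lt_trans (ler_normD _ _) _.
by move: (um k) (uy k) re; case: ee' => + _; lra.
Qed.

Lemma continuous_row (R : realType) (T : topologicalType) (n : nat)
    (f : 'I_n -> T -> R) : (forall i, continuous (f i)) ->
  continuous (fun x => \row_i f i x : 'rV[R]_n).
Proof.
move=> cf x; apply/cvg_ballP => e e0.
have : \forall y \near x, forall i, ball (f i x) e (f i y).
  by apply: filter_forall => i; exact: (cvg_ballP _ _).1 (cf i x) _ e0.
apply: filterS => y fy; split=> // i j; rewrite !mxE; exact: fy.
Qed.

(** A complementarity solution for [F] with an added zero component cannot lie outside the cube, by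
    coercivity. It is therefore interior to the simplex, where all components are equal, and equal
    to the zero one. *)
Theorem coercive_zero (R : realType) (n : nat) (F : 'I_n -> 'rV[R]_n -> R)
    (r : R) : 0 < r -> (forall i, continuous (F i)) ->
    (forall (v : 'rV[R]_n) i, r <= `|v ord0 i| -> 0 < \sum_j F j v * v ord0 j) ->
  exists v : 'rV[R]_n, forall i, F i v = 0.
Proof.
case: n F => [|n] F r0 cF coercive; first by exists 0 => -[].
(* [V] maps the standard simplex onto one containing the cube of radius [r];
   the slack barycentric coordinate [ord0] gets the component [0]. *)
pose L : R := 2 * n.+1%:R * r + 1.
have nr0 : 0 < n.+1%:R * r by rewrite mulr_gt0.
have L0 : 0 < L by rewrite /L; lra.
pose V (x : 'rV[R]_n.+2) : 'rV[R]_n.+1 :=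
  \row_i (L * x ord0 (lift ord0 i) - r).
have cV : continuous V.
  apply: continuous_row => i x.
  apply: (@continuousB _ _ _ (fun x : 'rV[R]_n.+2 => L * x ord0 (lift ord0 i)) (cst r)).
    apply: (@continuousM _ _ (cst L) (fun x : 'rV[R]_n.+2 => x ord0 (lift ord0 i))).
      exact: cst_continuous.
    exact: coord_continuous.
  exact: cst_continuous.
pose G (k : 'I_n.+2) (x : 'rV[R]_n.+2) : R :=
  if unlift ord0 k is Some i then F i (V x) else 0.
have G0 x : G ord0 x = 0 by rewrite /G unlift_none.
have GF i x : G (lift ord0 i) x = F i (V x) by rewrite /G liftK.
have [//|k|x [x0 x1 Gx]] := @simplex_complementarity R n.+2 G.
  rewrite /G; case: (unlift ord0 k) => [i|] x; last exact: cst_continuous.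
  exact: (continuous_comp (cV x) (cF i (V x))).
(* A weighted mean of components that are least wherever the weight is positive; it is at most every
   component, the zero one included. *)
pose s := \sum_k x ord0 k * G k x.
have sG k : s <= G k x.
  rewrite -[leRHS]mul1r -x1 mulr_suml; apply: ler_sum => i _.
  have := x0 i; rewrite le_eqVlt => /orP[/eqP<-|xi]; first by rewrite !mul0r.
  by rewrite ler_pM2l//; exact: Gx.
have s0 : s <= 0 by rewrite -(G0 x) sG.
(* As [V x] is affine in [x], the sum is [L * s] minus [r] times the sum of the components, which is
   at least [n.+1%:R * s]; [s <= 0] concludes. *)
have FV : \sum_j F j (V x) * V x ord0 j <= 0.
  have -> : \sum_j F j (V x) * V x ord0 j = L * s - r * \sum_j F j (V x).
    rewrite /s [in RHS]big_ord_recl G0 mulr0 add0r !mulr_sumr -sumrB.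
    by apply: eq_bigr => j _; rewrite GF mxE; ring.
  have : n.+1%:R * s <= \sum_j F j (V x).
    rewrite mulr_natl -[n.+1 in leLHS]card_ord -sumr_const.
    by apply: ler_sum => j _; rewrite -GF.
  move=> /(ler_wpM2l (ltW r0)); rewrite mulrA => h.
  have : (L - n.+1%:R * r) * s <= 0.
    by apply: mulr_ge0_le0 => //; rewrite /L; lra.
  rewrite mulrBl [n.+1%:R * r]mulrC; lra.
have Vr i : `|V x ord0 i| < r.
  by rewrite ltNge; apply/negP => /coercive; rewrite ltNge FV.
have xlift i : 0 < L * x ord0 (lift ord0 i) < 2 * r.
  by have := Vr i; rewrite mxE ltr_norml; move=> /andP[? ?]; apply/andP; lra.
have xpos k : 0 < x ord0 k.
  case: (unliftP ord0 k) => [i ->|->].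
    by have /andP[] := xlift i; rewrite pmulr_rgt0.
  (* [L] times each other coordinate is below [2 * r], which leaves a positive part of [L] to the
     slack coordinate. *)
  rewrite -(pmulr_rgt0 _ L0).
  have -> : x ord0 ord0 = 1 - \sum_i x ord0 (lift ord0 i).
    by rewrite -x1 big_ord_recl addrK.
  rewrite mulrBr mulr_sumr mulr1 subr_gt0.
  apply: (@le_lt_trans _ _ (\sum_(i < n.+1) 2 * r)).
    by apply: ler_sum => i _; have /andP[_ /ltW] := xlift i.
  by rewrite sumr_const card_ord -mulr_natl /L; lra.
exists (V x) => i; apply/eqP; rewrite eq_le -GF -[X in _ <= X](G0 x) Gx//=.
by rewrite -(G0 x) Gx.
Qed.

(** * Piecewise linear functions and their inner products *)

Definition node (R : realType) (s : seq R) (j : nat) : R := (0 :: s)`_j.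

Definition mesh_size (R : realType) (s : seq R) (j : nat) : R :=
  node s j.+1 - node s j.

(** The end values [a j] and [b j] are given cell by cell, without matching at the nodes, so that
    derivatives of piecewise linear functions fit too. *)
Definition affine_on_cells (R : realType) (s : seq R) (f : R -> R)
    (a b : nat -> R) : Prop :=
  forall j, (j < size s)%N -> forall x, mesh_cell s j x ->
    f x = a j + (b j - a j) / mesh_size s j * (x - node s j).

Lemma node_lt (R : realType) (s : seq R) (j : nat) :
  itv_partition 0 1 s -> (j < size s)%N -> node s j < node s j.+1.
Proof. by move=> [/(pathP 0) sP _] js; exact: sP. Qed.

Lemma mesh_size_gt0 (R : realType) (s : seq R) (j : nat) :
  itv_partition 0 1 s -> (j < size s)%N -> 0 < mesh_size s j.
Proof. by move=> sP js; rewrite subr_gt0 node_lt. Qed.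

Lemma node_last (R : realType) (s : seq R) :
  itv_partition 0 1 s -> node s (size s) = 1.
Proof. by move=> [_ /eqP <-]; rewrite /node (last_nth 0). Qed.

Lemma size_partition_gt0 (R : realType) (s : seq R) :
  itv_partition 0 1 s -> (0 < size s)%N.
Proof.
by case: s => // -[_ /eqP/= e]; move: (@ltr01 R); rewrite {1}e ltxx.
Qed.

Lemma node_le (R : realType) (s : seq R) (i j : nat) : itv_partition 0 1 s ->
  (i <= j)%N -> (j <= size s)%N -> node s i <= node s j.
Proof.
move=> sP; elim: j => [|j ih]; first by rewrite leqn0 => /eqP->.
rewrite leq_eqVlt => /orP[/eqP->//|]; rewrite ltnS => ij js.
by apply: le_trans (ih ij (ltnW js)) (ltW (node_lt sP js)).
Qed.

Lemma node_01 (R : realType) (s : seq R) (j : nat) : itv_partition 0 1 s ->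
  (j <= size s)%N -> 0 <= node s j <= 1.
Proof.
by move=> sP js; rewrite -[X in X <= _ <= _]/(node s 0) -(node_last sP) !node_le.
Qed.

Lemma integral_oo_poly (R : realType) (a b : R) (f : R -> R) (p : {poly R}) :
    a < b -> (forall x, a < x < b -> f x = p^`().[x]) ->
  measurable_fun `]a, b[ f /\
  (\int[lebesgue_measure]_(x in `]a, b[) (f x)%:E)%E = (p.[b] - p.[a])%:E.
Proof.
move=> ab fp.
have mp : measurable_fun `]a, b[ (horner p^`()).
  exact: measurable_poly.
have fpin : {in `]a, b[%classic, f =1 horner p^`()}.
  by move=> x; rewrite inE/= in_itv/= => /fp.
split; first by apply: eq_measurable_fun mp => x /fpin.
transitivity (\int[lebesgue_measure]_(x in `]a, b[) (p^`().[x])%:E)%E.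
  by apply: eq_integral => x /fpin ->.
rewrite -(@integral_itv_bndoo _ a b _ true false); last exact/measurable_EFinP.
rewrite (@continuous_FTC2 R _ (horner p))//.
- by apply: continuous_subspaceT; exact: continuous_horner.
- split.
  + by move=> x _; exact: derivable_horner.
  + by apply: cvg_at_right_filter; exact: continuous_horner.
  + by apply: cvg_at_left_filter; exact: continuous_horner.
- by move=> x _; rewrite derive.derivE.
Qed.

(** Induction on the number of cells. Measurability is carried along for the additivity of the
    integral; a node can be added to the interval on its left without changing the integral. *)
Lemma integral_cells (R : realType) (s : seq R) (f : R -> R)
    (p : nat -> {poly R}) (m : nat) : itv_partition 0 1 s ->
    (forall j, (j < size s)%N -> forall x, mesh_cell s j x ->
      f x = (p j)^`().[x]) ->
    (0 < m <= size s)%N ->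
  measurable_fun `]0, node s m[ f /\
  (\int[lebesgue_measure]_(x in `]0%R, node s m[) (f x)%:E)%E =
  (\sum_(j < m) ((p j).[node s j.+1] - (p j).[node s j]))%:E.
Proof.
move=> sP fp; elim: m => // m ih /= ms.
have cell j : (j < size s)%N -> forall x, node s j < x < node s j.+1 ->
    f x = (p j)^`().[x].
  by move=> js x xj; apply: fp => //; rewrite /mesh_cell/= in_itv.
have [m0|m0] := posnP m.
  rewrite m0 big_ord1 in ms *.
  exact: (@integral_oo_poly R (node s 0) _ _ _ (node_lt sP ms) (cell 0 ms)).
have [|mf fI] := ih; first by rewrite m0 ltnW.
have [mg gI] := integral_oo_poly (node_lt sP ms) (cell m ms).
have mlt : 0 < node s m.
  rewrite -[ltLHS]/(node s 0).
  apply: lt_le_trans (node_lt sP (leq_ltn_trans (leq0n m) ms)) _.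
  by rewrite node_le// ltnW.
have mf' : measurable_fun `]0, node s m] f.
  exact: (measurable_fun_itv_bndo_bndcP _ _ _).1 mf.
have -> : `]0, node s m.+1[%classic = `]0, node s m] `|` `]node s m, node s m.+1[ :> set R.
  rewrite -itv_bndbnd_setU//= bnd_simp; [exact: ltW | exact: node_lt].
split.
  by apply/measurable_funU.
rewrite integral_setU//=; last 2 first.
- by apply/measurable_EFinP/measurable_funU.
- apply/disj_setPS => y [/=]; rewrite 2!in_itv/= => /andP[_ ym] /andP[].
  by rewrite ltNge ym.
rewrite -(@integral_itv_bndo_bndc _ (BRight 0)); last exact/measurable_EFinP.
by rewrite fI gI big_ord_recr/= EFinD.
Qed.

(* The product on a cell is the derivative of a cubic in the distance to the
   left node, so its integral is Simpson's rule in bilinear form. *)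
Lemma L2dot_affine (R : realType) (s : seq R) (f g : R -> R)
    (a b c d : nat -> R) : itv_partition 0 1 s ->
    affine_on_cells s f a b -> affine_on_cells s g c d ->
  L2dot f g = \sum_(j < size s) mesh_size s j / 6 *
    (2 * a j * c j + a j * d j + b j * c j + 2 * b j * d j).
Proof.
move=> sP fa gc.
pose al j := (b j - a j) / mesh_size s j.
pose be j := (d j - c j) / mesh_size s j.
pose Y j : {poly R} := 'X - (node s j)%:P.
pose p j : {poly R} := (a j * c j) *: Y j
  + ((a j * be j + al j * c j) / 2) *: Y j ^+ 2 + (al j * be j / 3) *: Y j ^+ 3.
have [||_ /= I] := @integral_cells R s (fun x => f x * g x) p (size s) sP.
- move=> j js x xj; rewrite (fa j js x xj) (gc j js x xj) -/(al j) -/(be j).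
  rewrite /p /Y; move: (al j) (be j) => A B.
  by rewrite !poly.derivE !hornerE/=; field.
- by rewrite leqnn (size_partition_gt0 sP).
rewrite /L2dot /Rintegral -[X in `]0, X[](node_last sP) I/=.
apply: eq_bigr => j _; have := mesh_size_gt0 sP (ltn_ord j).
rewrite /p /Y /al /be !hornerE/= subrr -/(mesh_size s j).
move: (mesh_size s j) => h /lt0r_neq0 h0.
by field.
Qed.

Lemma affine_on_cellsD (R : realType) (s : seq R) (f g : R -> R)
    (a b c d : nat -> R) (l m : R) :
    affine_on_cells s f a b -> affine_on_cells s g c d ->
  affine_on_cells s (fun x => l * f x + m * g x)
    (fun j => l * a j + m * c j) (fun j => l * b j + m * d j).
Proof. by move=> fa gc j js x xj; rewrite (fa j js x xj) (gc j js x xj); ring. Qed.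

Lemma derive1_affine (R : realType) (s : seq R) (f : R -> R) (a b : nat -> R) :
    itv_partition 0 1 s -> affine_on_cells s f a b ->
  forall j, (j < size s)%N -> forall x, mesh_cell s j x ->
    derive1 f x = (b j - a j) / mesh_size s j.
Proof.
move=> sP fa j js x xj.
pose p : {poly R} := (a j)%:P + ((b j - a j) / mesh_size s j) *: ('X - (node s j)%:P).
have fp : \forall y \near x, f y = p.[y].
  have : nbhs x (mesh_cell s j) by apply: near_in_itvoo.
  by apply: filterS => y yj; rewrite (fa j js y yj) /p !hornerE.
rewrite derive1E (near_eq_derive _ fp) -derive1E -derive.derivE.
by rewrite /p !poly.derivE !hornerE.
Qed.

(** One-sided continuity at both ends of a cell identifies the end values of the polynomial with the
    nodal values. *)
Lemma Vh_affine (R : realType) (s : seq R) (v : R -> R) :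
    itv_partition 0 1 s -> in_Vh s v ->
  affine_on_cells s v (fun j => v (node s j)) (fun j => v (node s j.+1)).
Proof.
move=> sP [cv pv] j js; have [p sp vp] := pv j js.
have lt := node_lt sP js.
have /andP[a0 a1] := node_01 sP (ltnW js); have /andP[b0 b1] := node_01 sP js.
have /(continuous_within_itvP _ lt)[_ ca cb] :
    {within `[node s j, node s j.+1], continuous v}.
  apply: continuous_subspaceW cv => x /=; rewrite !in_itv/=.
  by move=> /andP[? ?]; apply/andP; lra.
have va : v (node s j) = p.[node s j].
  suff h : v x @[x --> (node s j)^'+] --> p.[node s j].
    exact: (cvg_unique _ ca h).
  have := cvg_at_right_filter (@continuous_horner R p (node s j)).
  apply: cvg_trans.
  apply: near_eq_cvg; near=> y; rewrite vp// /mesh_cell/= in_itv/=.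
  by apply/andP; split; near: y; [exact: nbhs_right_gt | exact: nbhs_right_lt].
have vb : v (node s j.+1) = p.[node s j.+1].
  suff h : v x @[x --> (node s j.+1)^'-] --> p.[node s j.+1].
    exact: (cvg_unique _ cb h).
  have := cvg_at_left_filter (@continuous_horner R p (node s j.+1)).
  apply: cvg_trans.
  apply: near_eq_cvg; near=> y; rewrite vp// /mesh_cell/= in_itv/=.
  by apply/andP; split; near: y; [exact: nbhs_left_gt | exact: nbhs_left_lt].
move=> x xj; rewrite va vb (vp x xj).
have -> : p = (p`_0)%:P + p`_1 *: 'X.
  apply/polyP => -[|[|i]]; rewrite coefD coefC coefZ coefX/= ?mulr0 ?mulr1 ?addr0 ?add0r//.
  by rewrite nth_default// (leq_trans sp).
rewrite !hornerE /mesh_size; field.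
by rewrite subr_eq0 gt_eqF.
Unshelve. all: by end_near. Qed.

(** * Continuity of polynomial expressions *)

Lemma continuous_addf (R : realType) (T : topologicalType) (f g : T -> R) :
  continuous f -> continuous g -> continuous (fun x => f x + g x).
Proof. by move=> cf cg x; apply: continuousD; [exact: cf|exact: cg]. Qed.

Lemma continuous_mulf (R : realType) (T : topologicalType) (f g : T -> R) :
  continuous f -> continuous g -> continuous (fun x => f x * g x).
Proof. by move=> cf cg x; apply: continuousM; [exact: cf|exact: cg]. Qed.

Lemma continuous_oppf (R : realType) (T : topologicalType) (f : T -> R) :
  continuous f -> continuous (fun x => - f x).
Proof. by move=> cf x; apply: continuousN; exact: cf. Qed.

Lemma continuous_exprf (R : realType) (T : topologicalType) (f : T -> R)
    (n : nat) : continuous f -> continuous (fun x => f x ^+ n).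
Proof.
by move=> cf x; exact: (continuous_comp (cf x) (@exprn_continuous R n (f x))).
Qed.

Ltac ring_continuity :=
  lazymatch goal with
  | |- continuous (fun v => @?f v + @?g v) =>
      apply: (@continuous_addf _ _ f g); ring_continuity
  | |- continuous (fun v => @?f v * @?g v) =>
      apply: (@continuous_mulf _ _ f g); ring_continuity
  | |- continuous (fun v => - @?f v) =>
      apply: (@continuous_oppf _ _ f); ring_continuity
  | |- continuous (fun v => @?f v ^+ ?n) =>
      apply: (@continuous_exprf _ _ f n); ring_continuity
  | |- _ => first [assumption | exact: cst_continuous]
  end.

Lemma continuous_sumf (R : realType) (T : topologicalType) (I : finType)
    (f : I -> T -> R) : (forall i, continuous (f i)) ->
  continuous (fun x => \sum_i f i x).
Proof.
move=> cf; apply: continuous_big => [|i _]; last exact: cf.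
exact: add_continuous.
Qed.

(** * Interpolation of nodal values *)

(** Each cell contributes its increment times the fraction of the cell to the left of [x]: a single
    formula, visibly continuous. *)
Definition interp (R : realType) (s : seq R) (v : nat -> R) (x : R) : R :=
  v 0%N + \sum_(j < size s) (v j.+1 - v j) / mesh_size s j *
    (Num.min (Num.max x (node s j)) (node s j.+1) - node s j).

(** Cells to the left contribute full increments, which telescope; cells to the right contribute
    nothing. *)
Lemma interpE (R : realType) (s : seq R) (v : nat -> R) (i : nat) (x : R) :
    itv_partition 0 1 s -> (i < size s)%N -> node s i <= x <= node s i.+1 ->
  interp s v x = v i + (v i.+1 - v i) / mesh_size s i * (x - node s i).
Proof.
move=> sP ilt /andP[ix xi].
pose F j := (v j.+1 - v j) / mesh_size s j *
    (Num.min (Num.max x (node s j)) (node s j.+1) - node s j).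
have Flt j : (j < i)%N -> F j = v j.+1 - v j.
  move=> ji; have js := ltn_trans ji ilt.
  have jx : node s j.+1 <= x by apply: le_trans ix; apply: node_le => //; exact: ltnW.
  have jj := ltW (node_lt sP js).
  rewrite /F max_l ?(le_trans jj)// min_r// divfK// gt_eqF//.
  exact: mesh_size_gt0.
have Fgt j : (i < j)%N -> (j < size s)%N -> F j = 0.
  move=> ij js; have xj : x <= node s j.
    by apply: (le_trans xi); apply: node_le => //; exact: ltnW.
  by rewrite /F max_r// min_l ?subrr ?mulr0// ltW// node_lt.
have Fi : F i = (v i.+1 - v i) / mesh_size s i * (x - node s i).
  by rewrite /F max_l// min_l.
rewrite /interp -/F.
rewrite -(big_mkord xpredT F) (big_cat_nat _ (n := i))//=; last exact: ltnW.
rewrite (@eq_big_nat _ _ _ 0%N i F (fun j => v j.+1 - v j)); last first.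
  by move=> j /andP[_ /Flt].
rewrite telescope_sumr// big_ltn// Fi.
rewrite big_nat big1 ?addr0 => [|j /andP[]]; last exact: Fgt.
by rewrite addrA (addrC (v 0%N)) subrK.
Qed.

Lemma interp_node (R : realType) (s : seq R) (v : nat -> R) (i : nat) :
  itv_partition 0 1 s -> (i <= size s)%N -> interp s v (node s i) = v i.
Proof.
move=> sP; rewrite leq_eqVlt => /orP[/eqP iN|ilt]; last first.
  by rewrite (interpE _ sP ilt) ?subrr ?mulr0 ?addr0// lexx ltW// node_lt.
case: i iN => [|i] iN; first by have := size_partition_gt0 sP; rewrite -iN.
have ilt : (i < size s)%N by rewrite -iN.
rewrite (interpE _ sP ilt) ?lexx ?andbT; last by rewrite ltW// node_lt.
by rewrite divfK 1?addrC ?subrK// gt_eqF// mesh_size_gt0.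
Qed.

Lemma continuous_interp (R : realType) (s : seq R) (v : nat -> R) :
  continuous (interp s v).
Proof.
apply: continuous_addf; first exact: cst_continuous.
apply: continuous_sumf => j; apply: continuous_mulf; first exact: cst_continuous.
apply: continuous_addf; last exact: cst_continuous.
move=> x.
apply: (@continuous_min R R (fun y => Num.max y (node s j)) (cst (node s j.+1))).
  by apply: (@continuous_max R R id (cst (node s j))) => //; exact: cst_continuous.
exact: cst_continuous.
Qed.

Lemma interp_Vh (R : realType) (s : seq R) (v : nat -> R) :
  itv_partition 0 1 s -> in_Vh s (interp s v).
Proof.
move=> sP; split; first by apply: continuous_subspaceT; exact: continuous_interp.
move=> j js; exists ((v j)%:P + ((v j.+1 - v j) / mesh_size s j) *: ('X - (node s j)%:P)).
  rewrite (leq_trans (size_polyD _ _))// geq_max.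
  rewrite (leq_trans (size_polyC_leq1 _))//.
  by rewrite (leq_trans (size_scale_leq _ _))// size_XsubC.
move=> x; rewrite /mesh_cell/= in_itv/= => /andP[x1 x2].
by rewrite (interpE _ sP js) ?hornerE// !ltW.
Qed.

(** * The scheme in nodal values *)

(** The exact integrals over a cell of length [h] of the mass, diffusion, [wd] and convection terms;
    [d] is the difference quotient, [w] the state, [p] the test function, and primes mark the right
    end. *)
Definition cell_form (R : realType) (nu wd h d d' w w' p p' : R) : R :=
  h / 6 * (2 * d * p + d * p' + d' * p + 2 * d' * p')
  + nu * ((w' - w) * (p' - p) / h) + wd * ((w' - w) * (p + p') / 2)
  + (w' - w) / 6 * (2 * w * p + w * p' + w' * p + 2 * w' * p').

Definition node_form (R : realType) (wd ci x p : R) : R :=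
  ((ci + wd) * x + 2 / (9 * ci) * x ^+ 3) * p.

(** The difference quotient [d] and the state [w] are separate arguments, so that the unknown may
    enter through both or through [d] alone. *)
Definition weak_form (R : realType) (nu wd : R) (c : 'I_2 -> R) (s : seq R)
    (d w p : nat -> R) : R :=
  \sum_(j < size s)
    cell_form nu wd (mesh_size s j) (d j) (d j.+1) (w j) (w j.+1) (p j) (p j.+1)
  + node_form wd (c ord0) (w 0%N) (p 0%N)
  + node_form wd (c ord_max) (w (size s)) (p (size s)).

Lemma theta_residualE (R : realType) (nu wd k theta : R) (c : 'I_2 -> R)
    (s : seq R) (W0 W1 phi : R -> R) : itv_partition 0 1 s ->
    in_Vh s W0 -> in_Vh s W1 -> in_Vh s phi ->
  theta_residual nu wd k theta c W0 W1 phi =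
  weak_form nu wd c s
    (fun j => (W1 (node s j) - W0 (node s j)) / k)
    (fun j => theta * W1 (node s j) + (1 - theta) * W0 (node s j))
    (fun j => phi (node s j)).
Proof.
move=> sP /(Vh_affine sP) a0 /(Vh_affine sP) a1 /(Vh_affine sP) ap.
pose W := theta_avg theta W0 W1.
have aW : affine_on_cells s W (W \o node s) (fun j => W (node s j.+1)).
  exact: affine_on_cellsD a1 a0.
have aD : affine_on_cells s (fun x => (W1 x - W0 x) / k)
    (fun j => (W1 (node s j) - W0 (node s j)) / k)
    (fun j => (W1 (node s j.+1) - W0 (node s j.+1)) / k).
  by move=> j js x xj; rewrite (a1 j js x xj) (a0 j js x xj); ring.
pose slope (f : R -> R) j := (f (node s j.+1) - f (node s j)) / mesh_size s j.
have aW' : affine_on_cells s (derive1 W) (slope W) (slope W).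
  by move=> j js x xj; rewrite (derive1_affine sP aW js xj) subrr !mul0r addr0.
have ap' : affine_on_cells s (derive1 phi) (slope phi) (slope phi).
  by move=> j js x xj; rewrite (derive1_affine sP ap js xj) subrr !mul0r addr0.
(* The slope is constant on a cell, so the convective product is again affine there. *)
have aWW' : affine_on_cells s (fun x => W x * derive1 W x)
    (fun j => W (node s j) * slope W j) (fun j => W (node s j.+1) * slope W j).
  move=> j js x xj; rewrite (derive1_affine sP aW js xj) (aW j js x xj) /slope /=.
  ring.
rewrite /theta_residual -/W (L2dot_affine sP aD ap) (L2dot_affine sP aW' ap').
rewrite (L2dot_affine sP aW' ap) (L2dot_affine sP aWW' ap).
rewrite big_ord_recl big_ord1 /weak_form addrA; congr (_ + _ + _).
- rewrite !mulr_sumr -!big_split/=; apply: eq_bigr => j _.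
  have := mesh_size_gt0 sP (ltn_ord j).
  rewrite /cell_form /slope -!/(theta_avg theta W0 W1 _) -/W.
  move: (mesh_size s j) (k^-1) => h ik /lt0r_neq0 h0.
  by clearbody W; field.
- rewrite node_last// (_ : lift ord0 ord0 = ord_max) ?mulr1n//.
  exact: val_inj.
Qed.

Lemma eq_weak_form (R : realType) (nu wd : R) (c : 'I_2 -> R) (s : seq R)
    (d d' w w' p p' : nat -> R) :
    (forall j, (j <= size s)%N -> d j = d' j) ->
    (forall j, (j <= size s)%N -> w j = w' j) ->
    (forall j, (j <= size s)%N -> p j = p' j) ->
  weak_form nu wd c s d w p = weak_form nu wd c s d' w' p'.
Proof.
move=> dd' ww' pp'; rewrite /weak_form !ww' ?pp'//; congr (_ + _ + _).
by apply: eq_bigr => j _; rewrite !dd' ?ww' ?pp'// ltnW.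
Qed.

Lemma weak_formP (R : realType) (nu wd : R) (c : 'I_2 -> R) (s : seq R)
    (d w p q : nat -> R) (l : R) :
  weak_form nu wd c s d w (fun j => l * p j + q j) =
  l * weak_form nu wd c s d w p + weak_form nu wd c s d w q.
Proof.
pose F r j := cell_form nu wd (mesh_size s j) (d j) (d j.+1) (w j) (w j.+1)
  (r j) (r j.+1).
have F_lin : \sum_(j < size s) F (fun j => l * p j + q j) j =
    l * \sum_(j < size s) F p j + \sum_(j < size s) F q j.
  rewrite mulr_sumr -big_split/=; apply: eq_bigr => j _.
  by rewrite /F /cell_form; ring.
by rewrite /weak_form F_lin /node_form; ring.
Qed.

Lemma weak_form_sum (R : realType) (nu wd : R) (c : 'I_2 -> R) (s : seq R)
    (d w : nat -> R) (n : nat) (l : 'I_n -> R) (p : 'I_n -> nat -> R) :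
  weak_form nu wd c s d w (fun j => \sum_i l i * p i j) =
  \sum_i l i * weak_form nu wd c s d w (p i).
Proof.
elim: n l p => [|n ih] l p.
  rewrite big_ord0; under [fun j => _]eq_fun do rewrite big_ord0.
  (* Linearity with both test functions zero and factor [-1] shows that the form vanishes on the
     zero test function. *)
  have := weak_formP nu wd c s d w (fun=> 0) (fun=> 0) (-1).
  under [in LHS]eq_fun do rewrite mulr0 addr0.
  by rewrite mulN1r addNr.
rewrite big_ord_recl -ih -weak_formP.
by congr weak_form; apply/funext => j; rewrite big_ord_recl.
Qed.

(** Reduces testing to the nodal hat functions. *)
Lemma weak_form_basis (R : realType) (nu wd : R) (c : 'I_2 -> R) (s : seq R)
    (d w p : nat -> R) :
  weak_form nu wd c s d w p =
  \sum_(i < (size s).+1) p i * weak_form nu wd c s d w (fun j => (j == i)%:R).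
Proof.
rewrite -weak_form_sum; apply: eq_weak_form => // j js.
rewrite (bigD1 (Ordinal (js : (j < (size s).+1)%N)))//= eqxx mulr1 big1 ?addr0//.
move=> i ij; have /negbTE -> : j != i by apply: contra ij => /eqP ji; apply/eqP/val_inj.
by rewrite mulr0.
Qed.

(** * Coercivity and solvability of the nodal system *)

Definition mass_form (R : realType) (s : seq R) (d p : nat -> R) : R :=
  \sum_(j < size s) mesh_size s j / 6 *
    (2 * d j * p j + d j * p j.+1 + d j.+1 * p j + 2 * d j.+1 * p j.+1).

Lemma weak_form_split (R : realType) (nu wd : R) (c : 'I_2 -> R) (s : seq R)
    (d w p : nat -> R) :
  weak_form nu wd c s d w p = mass_form s d p + weak_form nu wd c s (fun=> 0) w p.
Proof.
rewrite /weak_form /mass_form !addrA -big_split/=; congr (_ + _ + _).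
by apply: eq_bigr => j _; rewrite /cell_form; ring.
Qed.

(* This absorbs the boundary flux [x ^+ 3 / 3] of the convection term: with [t = x / (3 * ci)] the sum is
   [ci * x ^+ 2 * (1 + e * t + 2 * t ^+ 2)], and this is nonnegative. *)
Lemma node_form_ge0 (R : realType) (wd ci e x : R) : 0 <= wd -> 0 < ci ->
    e ^+ 2 = 1 ->
  0 <= node_form wd ci x x + e * (wd * x ^+ 2 / 2 + x ^+ 3 / 3).
Proof.
move=> wd0 c0 e1.
have -> : node_form wd ci x x + e * (wd * x ^+ 2 / 2 + x ^+ 3 / 3) =
    wd * (1 + e / 2) * x ^+ 2
    + ci * x ^+ 2 * (1 + e * (x / (3 * ci)) + 2 * (x / (3 * ci)) ^+ 2).
  by rewrite /node_form; field; exact: lt0r_neq0.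
have /orP[/eqP->|/eqP->] : (e == 1) || (e == -1) by rewrite -eqf_sqr e1 expr1n.
- rewrite addr_ge0// mulr_ge0 ?sqr_ge0//; first by nra.
    by rewrite mulr_ge0 ?sqr_ge0// ltW.
  by move: (_ / _) => t; nra.
- rewrite addr_ge0// mulr_ge0 ?sqr_ge0//; first by nra.
    by rewrite mulr_ge0 ?sqr_ge0// ltW.
  by move: (_ / _) => t; nra.
Qed.

(** The [wd] and convection terms integrate exactly to the difference of [g] between the ends. The
    boundary terms absorb [g], which enters with sign [-1] at 0 and [+1] at 1, and the diffusion
    that remains is a sum of squares. *)
Lemma weak_form_diag_ge0 (R : realType) (nu wd : R) (c : 'I_2 -> R) (s : seq R)
    (w : nat -> R) : itv_partition 0 1 s -> 0 <= nu -> 0 <= wd ->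
    (forall i, 0 < c i) ->
  0 <= weak_form nu wd c s (fun=> 0) w w.
Proof.
move=> sP nu0 wd0 c0; pose g x : R := wd * x ^+ 2 / 2 + x ^+ 3 / 3.
have -> : weak_form nu wd c s (fun=> 0) w w =
    \sum_(j < size s) nu * ((w j.+1 - w j) ^+ 2 / mesh_size s j)
    + (node_form wd (c ord0) (w 0%N) (w 0%N) - g (w 0%N))
    + (node_form wd (c ord_max) (w (size s)) (w (size s)) + g (w (size s))).
  have tel : \sum_(j < size s) (g (w j.+1) - g (w j)) = g (w (size s)) - g (w 0%N).
    by rewrite -(big_mkord xpredT (fun j => g (w j.+1) - g (w j))) telescope_sumr.
  have cells : \sum_(j < size s)
      cell_form nu wd (mesh_size s j) 0 0 (w j) (w j.+1) (w j) (w j.+1) =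
    \sum_(j < size s) nu * ((w j.+1 - w j) ^+ 2 / mesh_size s j)
    + (g (w (size s)) - g (w 0%N)).
    rewrite -tel -big_split/=; apply: eq_bigr => j _.
    have := mesh_size_gt0 sP (ltn_ord j).
    rewrite /cell_form /g; move: (mesh_size s j) => h /lt0r_neq0 h0.
    by field.
  by rewrite /weak_form cells; ring.
apply: addr_ge0; first apply: addr_ge0.
- apply: sumr_ge0 => j _; rewrite mulr_ge0// divr_ge0 ?sqr_ge0// ltW//.
  exact: mesh_size_gt0.
- by rewrite -mulN1r node_form_ge0// sqrrN expr1n.
- by rewrite -[g _]mul1r node_form_ge0// expr1n.
Qed.

(** With [M] the largest modulus of a coordinate and [B] the sum of the moduli of [b], the lower
    bound is at least [m * M ^+ 2 - B * M], which is positive once [M > B / m]. *)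
Lemma coercive_zero_quadratic (R : realType) (n : nat)
    (F : 'I_n -> 'rV[R]_n -> R) (m : R) (b : 'I_n -> R) :
    0 < m -> (forall i, continuous (F i)) ->
    (forall v : 'rV[R]_n,
      m * \sum_i v ord0 i ^+ 2 + \sum_i b i * v ord0 i <=
      \sum_i F i v * v ord0 i) ->
  exists v : 'rV[R]_n, forall i, F i v = 0.
Proof.
move=> m0 cF Fge; pose B := \sum_i `|b i|.
have B0 : 0 <= B by apply: sumr_ge0.
apply: (@coercive_zero R n F (B / m + 1)) => //.
  by rewrite ltr_wpDl// divr_ge0// ltW.
move=> v i vi; apply: lt_le_trans (Fge v).
have [k _ kmax] := @arg_maxP _ _ _ i xpredT (fun j => `|v ord0 j|) isT.
set M := `|v ord0 k| in kmax.
have MB : B < m * M.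
  rewrite mulrC -ltr_pdivrMr// -(ltrD2r 1) (le_lt_trans (le_trans vi (kmax i isT)))//.
  by rewrite ltrDl.
have M0 : 0 < M by rewrite -(pmulr_rgt0 _ m0) (le_lt_trans B0).
have sq : m * M ^+ 2 <= m * \sum_i v ord0 i ^+ 2.
  rewrite ler_pM2l// /M real_normK ?num_real// (bigD1 k)//= lerDl.
  by apply: sumr_ge0 => j _; exact: sqr_ge0.
have lin : - (B * M) <= \sum_i b i * v ord0 i.
  rewrite /B mulr_suml -sumrN; apply: ler_sum => j _.
  rewrite lerNl (le_trans (ler_norm _))// normrN normrM ler_wpM2l//.
  exact: kmax.
have : 0 < M * (m * M - B) by rewrite mulr_gt0// subr_gt0.
rewrite mulrBr; lra.
Qed.

Lemma exists_pos_lower_bound (R : realType) (f : nat -> R) (n : nat) :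
  (forall j, (j < n)%N -> 0 < f j) ->
  exists2 h, 0 < h & forall j, (j < n)%N -> h <= f j.
Proof.
elim: n => [|n ih] f0; first by exists 1.
have [j jn|h h0 hf] := ih; first by apply: f0; exact: ltnW.
exists (Num.min h (f n)); first by rewrite lt_min h0 f0.
move=> j; rewrite ltnS leq_eqVlt => /orP[/eqP->|/hf hfj].
  by rewrite ge_min lexx orbT.
by rewrite ge_min hfj.
Qed.

(** On a cell, [2 * x ^+ 2 + 2 * x * y + 2 * y ^+ 2] exceeds [x ^+ 2 + y ^+ 2] by the square of
    [x + y]. Every node is an end of some cell. *)
Lemma mass_form_coercive (R : realType) (s : seq R) : itv_partition 0 1 s ->
  exists2 m, 0 < m & forall w : nat -> R,
    m * \sum_(i < (size s).+1) w i ^+ 2 <= mass_form s w w.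
Proof.
move=> sP; have [j /(mesh_size_gt0 sP)//|h h0 hs] :=
  @exists_pos_lower_bound R (mesh_size s) (size s).
exists (h / 6); first by rewrite divr_gt0.
move=> w; apply: (@le_trans _ _
    (h / 6 * \sum_(j < size s) (w j ^+ 2 + w j.+1 ^+ 2))).
  rewrite ler_pM2l ?divr_gt0// big_ord_recr/= big_split/= lerD2l.
  have := size_partition_gt0 sP; case: (size s) => // n _.
  by rewrite big_ord_recr/= lerDr sumr_ge0// => j _; exact: sqr_ge0.
rewrite mulr_sumr; apply: ler_sum => j _.
have hj := hs j (ltn_ord j); have hj0 := le_trans (ltW h0) hj.
apply: (@le_trans _ _ (mesh_size s j / 6 * (w j ^+ 2 + w j.+1 ^+ 2))).
  by rewrite ler_wpM2r ?addr_ge0 ?sqr_ge0// ler_pM2r ?invr_gt0.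
apply: ler_wpM2l; first by rewrite divr_ge0.
by have := sqr_ge0 (w j + w j.+1); nra.
Qed.

Lemma continuous_weak_form (R : realType) (T : topologicalType) (nu wd : R)
    (c : 'I_2 -> R) (s : seq R) (d w : nat -> T -> R) (p : nat -> R) :
    (forall j, continuous (d j)) -> (forall j, continuous (w j)) ->
  continuous (fun v => weak_form nu wd c s (d^~ v) (w^~ v) p).
Proof.
move=> cd cw.
have cell h q q' (D D' W W' : T -> R) : continuous D -> continuous D' ->
    continuous W -> continuous W' ->
    continuous (fun v => cell_form nu wd h (D v) (D' v) (W v) (W' v) q q').
  move=> cD cD' cW cW'; rewrite /cell_form.
  ring_continuity.
have node_cont ci q (W : T -> R) : continuous W ->
    continuous (fun v => node_form wd ci (W v) q).
  move=> cW; rewrite /node_form.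
  ring_continuity.
apply: continuous_addf; last by apply: node_cont.
apply: continuous_addf; last by apply: node_cont.
by apply: continuous_sumf => j; apply: cell.
Qed.

Lemma mass_formE (R : realType) (c : 'I_2 -> R) (s : seq R) (d p : nat -> R) :
  mass_form s d p = weak_form 0 0 c s d (fun=> 0) p.
Proof.
rewrite /mass_form /weak_form /node_form !mulr0 expr0n !mulr0 !addr0 !mul0r !addr0.
by apply: eq_bigr => j _; rewrite /cell_form; ring.
Qed.

Lemma mass_form_shift (R : realType) (s : seq R) (u v p : nat -> R) (a : R) :
  mass_form s (fun j => a * (v j - u j)) p =
  a * mass_form s v p + mass_form s (fun j => - a * u j) p.
Proof.
rewrite /mass_form mulr_sumr -big_split/=; apply: eq_bigr => j _.
by ring.
Qed.

(* [b] tells whether the flux is taken at the unknown (theta > 0, unknown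
   W^{n+theta}) or at the known state [u] (theta = 0). *)
Lemma weak_form_solvable (R : realType) (nu wd a : R) (c : 'I_2 -> R)
    (s : seq R) (u : nat -> R) (b : bool) : itv_partition 0 1 s ->
    0 <= nu -> 0 <= wd -> (forall i, 0 < c i) -> 0 < a ->
  exists v : nat -> R, forall p, weak_form nu wd c s
    (fun j => a * (v j - u j)) (if b then v else u) p = 0.
Proof.
move=> sP nu0 wd0 c0 a0; have [m m0 mP] := mass_form_coercive sP.
(* Past [size s], [inord] gives a default index, but [weak_form] reads indices up to [size s]
   only. *)
pose val (v : 'rV[R]_(size s).+1) (j : nat) : R := v ord0 (inord j).
pose state v := if b then val v else u.
pose basis (i j : nat) : R := (j == i)%:R.
pose F (i : 'I_(size s).+1) v := weak_form nu wd c s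
  (fun j => a * (val v j - u j)) (state v) (basis i).
(* The part linear in the test function that does not involve the unknown. If [b] holds, the
   remaining flux tested with the unknown is nonnegative; otherwise the flux is known and belongs to
   the load. *)
pose load i := if b then weak_form 0 0 c s (fun j => - a * u j) (fun=> 0) (basis i)
  else weak_form nu wd c s (fun j => - a * u j) u (basis i).
have valE v (i : 'I_(size s).+1) : val v i = v ord0 i by rewrite /val inord_val.
have cval j : continuous (val^~ j) by exact: coord_continuous.
have [|i|v|v Fv] := @coercive_zero_quadratic R (size s).+1 F (a * m)
    (fun i : 'I_(size s).+1 => load i).
- exact: mulr_gt0.
- apply: (@continuous_weak_form _ _ nu wd c s (fun j v => a * (val v j - u j))
    (fun j v => state v j)) => j; last first.
    rewrite /state; case: (b); [exact: cval | exact: cst_continuous].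
  apply: continuous_mulf; first exact: cst_continuous.
  by apply: continuous_addf; [exact: cval | exact: cst_continuous].
- have -> : \sum_i F i v * v ord0 i = weak_form nu wd c s
      (fun j => a * (val v j - u j)) (state v) (val v).
    by rewrite [RHS]weak_form_basis; apply: eq_bigr => i _; rewrite mulrC valE.
  rewrite weak_form_split mass_form_shift.
  have : m * \sum_i v ord0 i ^+ 2 <= mass_form s (val v) (val v).
    by under eq_bigr do rewrite -valE; exact: mP.
  move=> /(ler_wpM2l (ltW a0)); rewrite mulrA -addrA => /lerD; apply.
  have -> : \sum_(i < (size s).+1) load i * v ord0 i =
      if b then weak_form 0 0 c s (fun j => - a * u j) (fun=> 0) (val v)
      else weak_form nu wd c s (fun j => - a * u j) u (val v).
    rewrite /load; case: (b); rewrite [RHS]weak_form_basis;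
      by apply: eq_bigr => i _; rewrite mulrC valE.
  rewrite /state; case: (b); last by rewrite -weak_form_split.
  by rewrite -mass_formE lerDl weak_form_diag_ge0.
exists (val v) => p; rewrite weak_form_basis big1// => i _.
by have := Fv i; rewrite /F /state /basis; case: (b) => ->; rewrite mulr0.
Qed.

Theorem lemma2p3 (R : realType) (nu wd : R) (c : 'I_2 -> R)
    (nu_gt0 : 0 < nu) (wd_ge0 : 0 <= wd) (c_gt0 : forall i, 0 < c i)
    (s : seq R) (s_partition : itv_partition 0 1 s)
    (theta k : R) (theta_ge0 : 0 <= theta) (theta_le1 : theta <= 1)
    (k_gt0 : 0 < k)
    (W0 : R -> R) (W0_Vh : in_Vh s W0) :
  exists W1 : R -> R, in_Vh s W1 /\
    forall phi : R -> R, in_Vh s phi ->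
      theta_residual nu wd k theta c W0 W1 phi = 0.
Proof.
pose u j := W0 (node s j).
have [w wP] : exists w : nat -> R, forall p, weak_form nu wd c s
    (fun j => (w j - u j) / k) (fun j => theta * w j + (1 - theta) * u j) p = 0.
  (* For [theta = 0] the flux is taken at the known state, and the unknown is the new state itself,
     with factor [k^-1]. *)
  have [->|theta0] := eqVneq theta 0.
    have k0 : 0 < k^-1 by rewrite invr_gt0.
    have [v vP] :=
      weak_form_solvable u false s_partition (ltW nu_gt0) wd_ge0 c_gt0 k0.
    exists v => p; rewrite -[RHS](vP p).
    by apply: eq_weak_form => // j _; rewrite ?[_ / k]mulrC// mul0r add0r subr0 mul1r.
  (* For unknown [v = theta * w + (1 - theta) * u] one has [w - u = (v - u) / theta], hence the
     factor [(theta * k)^-1]. *)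
  have thk : 0 < (theta * k)^-1 by rewrite invr_gt0 mulr_gt0// lt0r theta0.
  have [v vP] :=
    weak_form_solvable u true s_partition (ltW nu_gt0) wd_ge0 c_gt0 thk.
  exists (fun j => (v j - (1 - theta) * u j) / theta) => p.
  rewrite -[RHS](vP p); apply: eq_weak_form => // j _; field.
  - by rewrite theta0 gt_eqF.
  - by [].
exists (interp s w); split; first exact: interp_Vh.
move=> phi phi_Vh; have w_Vh := interp_Vh w s_partition.
rewrite (theta_residualE _ _ _ _ _ s_partition W0_Vh w_Vh phi_Vh).
rewrite -[RHS](wP (fun j => phi (node s j))).
by apply: eq_weak_form => // j js; rewrite interp_node.
Qed.
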